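(* Let $\Sigma$ be a connected $(X,2)$-arc-transitive graph of valency $4$ and let $\Delta$ be a self-paired $X$-orbit on $Arc_3(\Sigma)$. Then $\gimel(\Sigma,\Delta)\cong\Psi(\Sigma,J(\Delta))$.
   Context: Graphs are finite, simple, undirected; $\Sigma(\tau)$ is a neighbourhood. A $3$-arc is a sequence $(\alpha_0,\ldots,\alpha_3)$ of vertices with consecutive ones adjacent and $\alpha_0\ne\alpha_2$, $\alpha_1\ne\alpha_3$; $Arc_3(\Sigma)$ is their set. A $2$-path $[\alpha_0,\alpha_1,\alpha_2]$ is a sequence of three distinct vertices with $\alpha_1$ adjacent to $\alpha_0,\alpha_2$, identified with its reverse; $Path_2(\Sigma)$ is their set. $\Sigma$ is $(X,2)$-arc-transitive if $X$ acts preserving adjacency, transitively on vertices and on $2$-arcs. $\Delta$ is self-paired if closed under reversal. $\gimel(\Sigma,\Delta)$ has vertex set $Path_2(\Sigma)$ and edges $\{[\alpha_0,\alpha_1,\alpha_2],[\alpha_1,\alpha_2,\alpha_3]\}$ for $(\alpha_0,\ldots,\alpha_3)\in\Delta$. For a $3$-arc $\boldsymbol\alpha=(\tau_1,\tau,\sigma,\sigma_1)$ with $\Sigma(\tau)=\{\sigma,\tau_1,\tau_2,\tau_3\}$ and $\Sigma(\sigma)=\{\tau,\sigma_1,\sigma_2,\sigma_3\}$, let $J_{\boldsymbol\alpha}=([\tau_2,\tau,\tau_3],[\sigma_2,\sigma,\sigma_3])$, and $J(\Delta)=\{J_{\boldsymbol\alpha}:\boldsymbol\alpha\in\Delta\}$.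 $\Psi(\Sigma,J(\Delta))$ is the graph with vertex set $Path_2(\Sigma)$ in which $\boldsymbol\tau,\boldsymbol\sigma$ are adjacent iff $(\boldsymbol\tau,\boldsymbol\sigma)\in J(\Delta)$. *)

(* Defs.v *)
From HB Require Import structures.
From mathcomp Require Import all_boot.

Set Implicit Arguments.
Unset Strict Implicit.
Unset Printing Implicit Defensive.

Definition simple_graph (T : finType) (e : rel T) : Prop :=
  symmetric e /\ irreflexive e.

Definition connected_graph (T : finType) (e : rel T) : Prop :=
  forall x y : T, connect e x y.

Definition neighbours (T : finType) (e : rel T) (x : T) : {set T} :=
  [set y | e x y].

Definition has_valency (T : finType) (e : rel T) (k : nat) : Prop :=
  forall x : T, #|neighbours e x| = k.

Definition graph_iso (V W : finType) (r : rel V) (s : rel W) : Prop :=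
  exists2 f : V -> W, bijective f & forall u v, s (f u) (f v) = r u v.

Definition Arc2 (T : finType) (e : rel T) : {set T * T * T} :=
  [set a | let: (a0, a1, a2) := a in [&& e a0 a1, e a1 a2 & a0 != a2]].

Definition Arc3 (T : finType) (e : rel T) : {set T * T * T * T} :=
  [set a | let: (a0, a1, a2, a3) := a in
    [&& e a0 a1, e a1 a2, e a2 a3, a0 != a2 & a1 != a3]].

(* The 2-path [a0, a1, a2] is the class {(a0, a1, a2), (a2, a1, a0)} of a
   sequence modulo reversal. *)
Definition path2 (T : finType) (a0 a1 a2 : T) : {set T * T * T} :=
  [set (a0, a1, a2); (a2, a1, a0)].

Definition Path2 (T : finType) (e : rel T) : {set {set T * T * T}} :=
  [set path2 a.1.1 a.1.2 a.2 | a : T * T * T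
     & [&& uniq [:: a.1.1; a.1.2; a.2], e a.1.2 a.1.1 & e a.1.2 a.2]].

Definition path2_of (T : finType) (e : rel T) : finType :=
  {P : {set T * T * T} | P \in Path2 e}.

(* X need be neither finite nor faithful on T, so the actions of the fingroup
   library, which are those of finite groups, are not used. *)
Record graph_action (T : finType) (e : rel T) (X : groupType)
    (act : T -> X -> T) : Prop := GraphAction {
  act1 : forall a, act a 1%g = a;
  actM : forall a x y, act a (x * y)%g = act (act a x) y;
  act_adj : forall x a b, e (act a x) (act b x) = e a b
}.

Definition act3 (T : finType) (X : groupType) (act : T -> X -> T)
    (a : T * T * T) (x : X) : T * T * T :=
  let: (a0, a1, a2) := a in (act a0 x, act a1 x, act a2 x).

Definition act4 (T : finType) (X : groupType) (act : T -> X -> T)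
    (a : T * T * T * T) (x : X) : T * T * T * T :=
  let: (a0, a1, a2, a3) := a in (act a0 x, act a1 x, act a2 x, act a3 x).

Definition transitive_on (U : finType) (X : groupType) (act : U -> X -> U)
    (S : {set U}) : Prop :=
  {in S &, forall a b, exists x : X, act a x = b}.

Definition arc2_transitive (T : finType) (e : rel T) (X : groupType)
    (act : T -> X -> T) : Prop :=
  [/\ graph_action e act, transitive_on act [set: T]
    & transitive_on (act3 act) (Arc2 e)].

Definition orbit_on (U : finType) (X : groupType) (act : U -> X -> U)
    (S D : {set U}) : Prop :=
  exists2 a, a \in S & forall b, b \in D <-> exists x : X, b = act a x.

Definition self_paired (T : finType) (D : {set T * T * T * T}) : Prop :=
  forall a0 a1 a2 a3, (a0, a1, a2, a3) \in D -> (a3, a2, a1, a0) \in D.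

Definition gimel (T : finType) (e : rel T) (D : {set T * T * T * T}) :
    rel (path2_of e) :=
  fun P Q => [exists a0, exists a1, exists a2, exists a3,
    ((a0, a1, a2, a3) \in D) &&
    ([set val P; val Q] == [set path2 a0 a1 a2; path2 a1 a2 a3])].

(* [J e D] collects the pairs J_a, a = (t1, t, s, s1) in D. In a graph of
   valency 4 the equations below determine {t2, t3} and {s2, s3}, hence J_a. *)
Definition J (T : finType) (e : rel T) (D : {set T * T * T * T}) :
    {set path2_of e * path2_of e} :=
  [set PQ : path2_of e * path2_of e |
    [exists t1, exists t, exists s, exists s1,
     exists t2, exists t3, exists s2, exists s3,
    [&& (t1, t, s, s1) \in D,
        neighbours e t == [set s; t1; t2; t3],
        neighbours e s == [set t; s1; s2; s3],
        val PQ.1 == path2 t2 t t3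
      & val PQ.2 == path2 s2 s s3]]].

Definition Psi (T : finType) (e : rel T)
    (A : {set path2_of e * path2_of e}) : rel (path2_of e) :=
  fun P Q => (P, Q) \in A.

Arguments gimel {T} e D.
Arguments J {T} e D.

Lemma gimel_simple (T : finType) (e : rel T) (D : {set T * T * T * T}) :
  simple_graph e -> D \subset Arc3 e -> simple_graph (gimel e D).
Proof.
move=> [_ irr] /subsetP sD; split=> [P Q|P]; first by rewrite /gimel setUC.
apply/negbTE/negP; rewrite /gimel => /existsP[a0 /existsP[a1 /existsP[a2 /existsP[a3 /andP[aD /eqP E]]]]].
move: (sD _ aD); rewrite inE => /and5P[_ e12 _ _ _].
have E1 : path2 a0 a1 a2 = path2 a1 a2 a3.
  have : path2 a0 a1 a2 \in [set val P; val P] by rewrite E !inE eqxx.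
  have : path2 a1 a2 a3 \in [set val P; val P] by rewrite E !inE eqxx orbT.
  by rewrite !inE !orbb => /eqP -> /eqP ->.
have : (a0, a1, a2) \in path2 a1 a2 a3 by rewrite -E1 !inE eqxx.
rewrite !inE !xpair_eqE => /orP[]/andP[/andP[_ /eqP E2] _].
  by rewrite E2 irr in e12.
by rewrite E2 irr in e12.
Qed.

Lemma Psi_simple (T : finType) (e : rel T) (D : {set T * T * T * T}) :
  simple_graph e -> D \subset Arc3 e -> self_paired D ->
  simple_graph (Psi (J e D)).
Proof.
move=> [_ irr] /subsetP sD sp; split.
  suff H P Q : Psi (J e D) P Q -> Psi (J e D) Q P by move=> P Q; apply/idP/idP; apply: H.
  rewrite /Psi !inE /=.
  move=> /existsP[t1 /existsP[t /existsP[s /existsP[s1 /existsP[t2 /existsP[t3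
    /existsP[s2 /existsP[s3 /and5P[aD Nt Ns EP EQ]]]]]]]]].
  apply/existsP; exists s1; apply/existsP; exists s; apply/existsP; exists t.
  apply/existsP; exists t1; apply/existsP; exists s2; apply/existsP; exists s3.
  apply/existsP; exists t2; apply/existsP; exists t3.
  by rewrite sp // Nt Ns EP EQ.
move=> P; apply/negbTE/negP; rewrite /Psi inE /=.
move=> /existsP[t1 /existsP[t /existsP[s /existsP[s1 /existsP[t2 /existsP[t3
  /existsP[s2 /existsP[s3 /and5P[aD _ _ /eqP EP /eqP EQ]]]]]]]]].
move: (sD _ aD); rewrite inE => /and5P[_ ets _ _ _].
have : (t2, t, t3) \in path2 s2 s s3 by rewrite -EQ EP !inE eqxx.
by rewrite !inE !xpair_eqE => /orP[]/andP[/andP[_ /eqP E] _]; rewrite E irr in ets.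
Qed.

(* Main.v *)
Require Import Defs.
From mathcomp Require Import all_boot.

(** In valency 4, sending a 2-path [a, t, b] to [c, t, d], where c and d are the
    other two neighbours of t, is an involution of Path_2. For a 3-arc
    (t1, t, s, s1) it exchanges the pair ([t1, t, s], [t, s, s1]), which spans an
    edge of gimel, with J_(t1, t, s, s1), which spans an edge of Psi. Hence it is
    the required isomorphism. *)

Set Implicit Arguments.
Unset Strict Implicit.
Unset Printing Implicit Defensive.

Lemma path2C (T : finType) (a t b : T) : path2 a t b = path2 b t a.
Proof. exact: setUC. Qed.

Lemma eq_set2 (T : finType) (a b c d : T) :
  [set a; b] = [set c; d] -> (a = c /\ b = d) \/ (a = d /\ b = c).
Proof.
move=> E.
have : a \in [set c; d] by rewrite -E set21.
have : b \in [set c; d] by rewrite -E set22.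
have : c \in [set a; b] by rewrite E set21.
have : d \in [set a; b] by rewrite E set22.
by do 4![case/set2P=> ?]; subst; auto.
Qed.

(** Serves to exchange the roles of the ends of a 2-path and of the two remaining neighbours of its
    centre. *)
Lemma set4C (T : finType) (a b c d : T) :
  [set a; b; c; d] = [set c; d; a; b].
Proof. by rewrite -setUA setUC setUA. Qed.

Lemma card_set4_uniq (T : finType) (a b c d : T) :
  #|[set a; b; c; d]| = 4 -> uniq [:: a; b; c; d].
Proof.
move=> E; apply/card_uniqP; rewrite /= -E; apply: eq_card => x.
by rewrite !inE !orbA.
Qed.

Lemma set4_compl2 (T : finType) (A : {set T}) (a b : T) :
  #|A| = 4 -> a \in A -> b \in A -> a != b ->
  exists c d, A = [set a; b; c; d].
Proof.
move=> cA aA bA nab.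
have sA : [set a; b] \subset A by apply/subsetP=> x /set2P[]->.
have /eqP/cards2P[c [d [_ E]]] : #|A :\: [set a; b]| = 2.
  by rewrite cardsDS // cA cards2 nab.
exists c, d; rewrite -(setID A [set a; b]) (setIidPr sA) E.
by rewrite setUA.
Qed.

(** Each group element preserves adjacency and, having an inverse, acts injectively, so it keeps
    both the edges and the two inequalities of a 3-arc. *)
Lemma orbit_on_subset (T : finType) (e : rel T) (X : groupType)
    (act : T -> X -> T) (D : {set T * T * T * T}) :
  graph_action e act -> orbit_on (act4 act) (Arc3 e) D -> D \subset Arc3 e.
Proof.
move=> [act_1 act_M act_e] [[[[a0 a1] a2] a3] aA orb].
apply/subsetP=> b /orb[x ->{b}]; move: aA; rewrite !inE /= !act_e.
have act_inj : injective (act^~ x).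
  by apply: (can_inj (g := act^~ x^-1%g)) => a; rewrite -act_M mulgV act_1.
by rewrite !(inj_eq act_inj).
Qed.

(* Since path2 a t b lists both (a, t, b) and (b, t, a), avoiding the first
   entry of every member means avoiding both end vertices. *)
Definition path2_compl (T : finType) (e : rel T) (P : {set T * T * T}) :
    {set T * T * T} :=
  [set x | [&& e x.1.2 x.1.1, e x.1.2 x.2, x.1.1 != x.2
    & [forall p in P, [&& x.1.2 == p.1.2, x.1.1 != p.1.1 & x.2 != p.1.1]]]].

Lemma path2_complE (T : finType) (e : rel T) (t a b c d : T) :
  has_valency e 4 -> neighbours e t = [set a; b; c; d] ->
  path2_compl e (path2 a t b) = path2 c t d.
Proof.
(* Valency 4 forces the four listed neighbours to be distinct. *)
move=> val4 Nt; have /card_set4_uniq : #|[set a; b; c; d]| = 4 by rewrite -Nt.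
rewrite /= !inE !negb_or -!andbA => /and5P[nab nac nad nbc /and3P[nbd ncd _]].
have et x : e t x = [|| x == a, x == b, x == c | x == d].
  by have := in_set (e t) x; rewrite -/(neighbours e t) Nt !inE -!orbA => ->.
apply/setP=> -[[x u] y]; rewrite !inE /= !xpair_eqE.
apply/idP/idP.
  case/and4P=> eux euy nxy /forall_inP H.
  (* The member [(a, t, b)] fixes the centre and excludes [a]; its reverse excludes [b]. Only [c]
     and [d] remain for the distinct ends [x] and [y]. *)
  have /and3P[/eqP /= E nxa nya] := H (a, t, b) (set21 _ _); subst u.
  have /and3P[_ /= nxb nyb] := H (b, t, a) (set22 _ _).
  move: eux euy nxy; rewrite !et !eqxx !andbT.
  rewrite (negPf nxa) (negPf nya) (negPf nxb) (negPf nyb) /=.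
  by case/pred2P=> -> /pred2P[]->; rewrite !eqxx ?orbT.
have H z : z \in [:: c; d] -> [&& e t z, z != a & z != b].
  by rewrite !inE et => /pred2P[]->; rewrite eqxx !orbT /=;
     apply/andP; split; rewrite eq_sym.
have /and3P[etc nca ncb] := H c (mem_head _ _).
have /and3P[etd nda ndb] : [&& e t d, d != a & d != b].
  by apply: H; rewrite !inE eqxx orbT.
by case/orP=> /andP[/andP[/eqP-> /eqP->] /eqP->];
  rewrite etc etd /= 1?[d == c]eq_sym ncd;
  apply/forall_inP=> p /set2P[]-> /=; rewrite eqxx ?nca ?ncb ?nda ?ndb.
Qed.

Section Complement.

Variables (T : finType) (e : rel T).
Hypotheses (sg : simple_graph e) (val4 : has_valency e 4).

(** Normal form of a 2-path that also names the other two neighbours of its centre, so that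
    [path2_complE] applies directly. *)
Lemma Path2P (P : {set T * T * T}) :
  reflect (exists t a b c d,
             P = path2 a t b /\ neighbours e t = [set a; b; c; d])
          (P \in Path2 e).
Proof.
apply: (iffP imsetP) => [[[[a t] b]]|[t [a [b [c [d [-> Nt]]]]]]].
  rewrite inE /= !inE !negb_or -!andbA => /and5P[_ nab _ _ /andP[ea eb]] ->.
  have [|||c [d Nt]] := @set4_compl2 _ (neighbours e t) a b (val4 t); rewrite ?inE //.
  by exists t, a, b, c, d.
exists (a, t, b) => //; have /card_set4_uniq : #|[set a; b; c; d]| = 4 by rewrite -Nt.
rewrite /= !inE !negb_or -!andbA => /and4P[nab _ _ _].
have ea : e t a by rewrite -[e t a]in_set -/(neighbours e t) Nt !inE eqxx.
have eb : e t b by rewrite -[e t b]in_set -/(neighbours e t) Nt !inE eqxx orbT.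
rewrite nab ea eb !andbT /=.
by apply/andP; split; apply/eqP=> E; [move: ea | move: eb]; rewrite E sg.2.
Qed.

Lemma path2_compl_closed (P : {set T * T * T}) :
  P \in Path2 e -> path2_compl e P \in Path2 e.
Proof.
case/Path2P=> t [a [b [c [d [-> Nt]]]]]; apply/Path2P.
exists t, c, d, a, b; split; first exact: path2_complE.
by rewrite Nt set4C.
Qed.

Lemma path2_complK (P : {set T * T * T}) :
  P \in Path2 e -> path2_compl e (path2_compl e P) = P.
Proof.
case/Path2P=> t [a [b [c [d [-> Nt]]]]].
rewrite (path2_complE val4 Nt); apply: path2_complE => //.
by rewrite Nt set4C.
Qed.

Definition path2_of_compl (P : path2_of e) : path2_of e :=
  exist _ (path2_compl e (val P)) (path2_compl_closed (valP P)).

Lemma path2_of_complK : involutive path2_of_compl.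
Proof. by move=> P; apply: val_inj; rewrite /= path2_complK ?(valP P). Qed.

Lemma gimel_path2_of_compl (D : {set T * T * T * T}) (P Q : path2_of e) :
  D \subset Arc3 e -> self_paired D ->
  Psi (J e D) (path2_of_compl P) (path2_of_compl Q) = gimel e D P Q.
Proof.
move=> sD sp; have Psi_sym := (Psi_simple sg sD sp).1.
apply/idP/idP.
  rewrite /Psi inE /=.
  move=> /existsP[t1 /existsP[t /existsP[s /existsP[s1 /existsP[t2 /existsP[t3
    /existsP[s2 /existsP[s3 /and5P[aD /eqP Nt /eqP Ns /eqP EP /eqP EQ]]]]]]]]].
  apply/existsP; exists t1; apply/existsP; exists t.
  apply/existsP; exists s; apply/existsP; exists s1.
  (* The pair in [J] describes the complements of [P] and [Q]; complementing once more recovers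
     [t1, t, s] and [t, s, s1]. *)
  rewrite aD -(path2_complK (valP P)) -(path2_complK (valP Q)) EP EQ.
  rewrite (path2C t1) (@path2_complE _ e t t2 t3 s t1) //; last first.
    by rewrite Nt set4C.
  rewrite (@path2_complE _ e s s2 s3 t s1) ?eqxx //.
  by rewrite Ns set4C.
case/existsP=> a0 /existsP[a1 /existsP[a2 /existsP[a3 /andP[aD /eqP E]]]].
have := subsetP sD _ aD; rewrite inE => /and5P[e01 e12 e23 n02 n13].
move/eq_set2: E => EPQ.
(* An edge of [gimel] is an unordered pair whereas [J] consists of ordered ones; the symmetry of
   [Psi], which comes from self-pairedness, allows the order to be fixed. *)
wlog [EP EQ] : P Q {EPQ} / val P = path2 a0 a1 a2 /\ val Q = path2 a1 a2 a3.
  by move=> W; case: EPQ => -[EP EQ]; [|rewrite Psi_sym]; apply: W; split.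
(* The inequalities of the 3-arc make the two named neighbours distinct; [a2] is listed before [a0]
   to match the order used in [J]. *)
have [||||t2 [t3 Nt]] := @set4_compl2 _ (neighbours e a1) a2 a0;
  rewrite ?inE // 1?sg.1 1?eq_sym //.
have [||||s2 [s3 Ns]] := @set4_compl2 _ (neighbours e a2) a1 a3;
  rewrite ?inE // 1?sg.1 1?eq_sym //.
rewrite /Psi inE /=.
apply/existsP; exists a0; apply/existsP; exists a1; apply/existsP; exists a2.
apply/existsP; exists a3; apply/existsP; exists t2; apply/existsP; exists t3.
apply/existsP; exists s2; apply/existsP; exists s3.
rewrite aD EP EQ Nt Ns (path2C a0) (path2_complE val4 Nt) (path2_complE val4 Ns).
by rewrite !eqxx.
Qed.

End Complement.

Theorem theorem6p1 (T : finType) (e : rel T) (X : groupType)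
    (act : T -> X -> T) (Delta : {set T * T * T * T}) :
  simple_graph e ->
  connected_graph e ->
  arc2_transitive e act ->
  has_valency e 4 ->
  orbit_on (act4 act) (Arc3 e) Delta ->
  self_paired Delta ->
  graph_iso (gimel e Delta) (Psi (J e Delta)).
Proof.
move=> sg _ [ga _ _] val4 orb sp.
exists (path2_of_compl sg val4).
  exact: inv_bij (path2_of_complK sg val4).
by move=> P Q; apply: gimel_path2_of_compl => //; apply: orbit_on_subset orb.
Qed.
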